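(* Let $(X_n:n\in\omega)$ be a sequence of non-trivial (countably infinite) sets and, for each $n$, let $G_n$ be a transitive group of permutations of $X_n$. Let $\mathfrak{N}$ be the Fraenkel--Mostowski model determined from this sequence of sets and group actions, with set of atoms $U$. Then $|U|\in\Delta$ in $\mathfrak{N}$ if and only if $dcl$ is locally finite for each $G_n$ on $X_n$.
   Context: $\Delta$ is the class of cardinalities of Dedekind finite sets, i.e. sets with no countably infinite subset. For a group $G$ of permutations of a set $X$ and $A\subseteq X$, the definable closure $dcl(A)$ is the set of all $x\in X$ fixed by every element of the pointwise stabilizer of $A$ in $G$. $dcl$ is locally finite if $dcl(A)$ is finite whenever $A$ is finite. Fraenkel--Mostowski models. FMC is ZFC modified to allow a set $U$ of atoms (objects with no elements, distinct from $\emptyset$), with extensionality restricted to non-atoms. Given a ground model $\mathfrak{M}$ of FMC with set of atoms $U$ and a group $\mathcal{G}\in\mathfrak{M}$ of permutations of $U$, let $\mathcal{G}$ act on $\mathfrak{M}$ by $g(x)=\{g(y):y\in x\}$; write $\mathcal{G}_{\{x\}}=\{g\in \mathcal{G}:g(x)=x\}$ and $\mathcal{G}_x=\{g\in \mathcal{G}: g(y)=y \text{ for all } y\in x\}$. The finite support filter $\mathfrak{F}$ is the family of subgroups of $\mathcal{G}$ containing $\mathcal{G}_A$ for some finite $A\subseteq U$, and the model determined by $\mathcal{G}$ with finite supports is $\mathfrak{N}=\{x\in\mathfrak{M}: \mathcal{G}_{\{x\}}\in\mathfrak{F}\wedge x\subseteq\mathfrak{N}\}$ (defined by transfinite induction).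 The model determined by the sequences $(X_n)$, $(G_n)$ (taken in the ground model). The set of atoms $U$ is indexed by the finite sequences $(x_i:i<n)$ with $x_i\in X_i$, $n\in\omega$; under extension $U$ is a tree with $\omega$ levels. For each $\sigma\in U$ of length $n$ the set of immediate successors of $\sigma$ is a copy of $X_n$, on which $G_n$ acts; for $g\in G_n$ this gives the tree automorphism of $U$ that fixes every sequence not properly extending $\sigma$, and acts on each sequence properly extending $\sigma$ by applying $g$ to its $(n+1)$th entry and leaving all other entries unchanged. $\mathcal{G}$ is the group of tree automorphisms of $U$ generated by all these actions, for all $n$ and all $\sigma$ of length $n$ (an iterated wreath product of the groups $G_n$). $\mathfrak{N}$ is the Fraenkel--Mostowski model determined by $\mathcal{G}$ with finite supports. *)

(* Defs.v *)
From mathcomp Require Import all_boot.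
From mathcomp Require Import boolp classical_sets functions cardinality.

Set Implicit Arguments.
Unset Strict Implicit.
Unset Printing Implicit Defensive.

Local Open Scope classical_set_scope.
Local Open Scope card_scope.

(** * Permutation groups and definable closure *)

Definition perm_group_axiom (X : Type) (G : set (X -> X)) : Prop :=
  [/\ forall g, G g -> bijective g,
      G id,
      forall g h, G g -> G h -> G (g \o h)
    & forall g h, G g -> cancel g h -> cancel h g -> G h].

Record perm_group (X : Type) := PermGroup {
  pg_set :> set (X -> X);
  pg_axiom : perm_group_axiom pg_set
}.

Definition pointwise_stab (X : Type) (G : set (X -> X)) (A : set X) :
    set (X -> X) :=
  [set g | G g /\ forall a, A a -> g a = a].

Definition dcl (X : Type) (G : set (X -> X)) (A : set X) : set X :=
  [set x | forall g, pointwise_stab G A g -> g x = x].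

Definition dcl_locally_finite (X : Type) (G : set (X -> X)) : Prop :=
  forall A, finite_set A -> finite_set (dcl G A).

Definition transitive_group (X : Type) (G : set (X -> X)) : Prop :=
  forall x y, exists2 g, G g & g x = y.

(** * Structures for the language of set theory with atoms *)

(* Equality is an interpreted relation, because the universe [atomic_set]
   below is a setoid. All quantifiers in the notions that follow range over
   the domain of the structure. *)
Record set_structure := SetStructure {
  st_dom :> Type;
  st_eq : st_dom -> st_dom -> Prop;
  st_mem : st_dom -> st_dom -> Prop;
  st_set : st_dom -> Prop (* being a set, i.e. not an atom *)
}.

Section SetTheory.
Variable M : set_structure.
Implicit Types x y z a b p f s A B D w : M.
Local Notation "x ≈ y" := (st_eq x y) (at level 70).
Local Notation "x ∈ y" := (st_mem x y) (at level 70).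

Definition st_subset A B := st_set A /\ forall z, z ∈ A -> z ∈ B.

Definition st_empty x := st_set x /\ forall z, ~ z ∈ x.

(* s = {a, b} *)
Definition st_unordered_pair s a b :=
  st_set s /\ forall z, z ∈ s <-> z ≈ a \/ z ≈ b.

(* p = (a, b) = {{a}, {a, b}} *)
Definition st_pair p a b :=
  exists s d, [/\ st_unordered_pair s a a, st_unordered_pair d a b
                & st_unordered_pair p s d].

(* s = x U {x} *)
Definition st_succ s x := st_set s /\ forall z, z ∈ s <-> z ∈ x \/ z ≈ x.

Definition st_inductive w :=
  [/\ st_set w, exists2 e, st_empty e & e ∈ w
    & forall x, x ∈ w -> exists2 s, st_succ s x & s ∈ w].

Definition st_omega w :=
  st_inductive w /\ forall w', st_inductive w' -> st_subset w w'.

Definition st_maps f a b := exists2 p, st_pair p a b & p ∈ f.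

Definition st_bijection f A B :=
  [/\ st_set f,
      forall p, p ∈ f -> exists a b, [/\ a ∈ A, b ∈ B & st_pair p a b],
      forall a, a ∈ A ->
        (exists b, st_maps f a b) /\
        (forall b b', st_maps f a b -> st_maps f a b' -> b ≈ b')
    & forall b, b ∈ B ->
        (exists a, st_maps f a b) /\
        (forall a a', st_maps f a b -> st_maps f a' b -> a ≈ a')].

Definition st_equinumerous A B := exists f, st_bijection f A B.

Definition st_countably_infinite B :=
  exists2 w, st_omega w & st_equinumerous w B.

Definition st_dedekind_finite A :=
  st_set A /\ ~ exists2 B, st_subset B A & st_countably_infinite B.

(* |A| \in Delta: |A| is the cardinality of some Dedekind finite set. *)
Definition card_in_Delta A :=
  exists2 D, st_dedekind_finite D & st_equinumerous A D.

End SetTheory.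

(** * Fraenkel-Mostowski models *)

(* The cumulative hierarchy over a type U of atoms, in Aczel's encoding:
   [Sup f] is the set of all [f i]. *)
Inductive atomic_set (U : Type) : Type :=
| Atom of U
| Sup (T : Type) of (T -> atomic_set U).

Section FraenkelMostowski.
Variable U : Type.
Local Notation V := (atomic_set U).

Fixpoint aeq (x y : V) : Prop :=
  match x, y with
  | Atom u, Atom v => u = v
  | Sup P f, Sup T g => (forall i, exists j, aeq (f i) (g j)) /\
                        (forall j, exists i, aeq (f i) (g j))
  | _, _ => False
  end.

Definition amem (y x : V) : Prop :=
  if x is Sup T f then exists i, aeq y (f i) else False.

Definition is_set (x : V) : Prop := if x is Sup _ _ then True else False.

Definition atoms : V := Sup (@Atom U).

(* g(x) = {g(y) : y \in x} *)
Fixpoint aact (g : U -> U) (x : V) : V :=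
  match x with
  | Atom u => Atom (g u)
  | Sup T f => Sup (fun i => aact g (f i))
  end.

Variable G : perm_group U.

Definition setwise_stab (x : V) : set (U -> U) :=
  [set g | pg_set G g /\ aeq (aact g x) x].

Definition finite_support_filter : set (set (U -> U)) :=
  [set H | [/\ perm_group_axiom H, H `<=` G
             & exists2 A, finite_set A & pointwise_stab G A `<=` H]].

Inductive in_FM (x : V) : Prop :=
  InFM of finite_support_filter (setwise_stab x)
        & (forall y, amem y x -> in_FM y).

Definition FM : set_structure :=
  @SetStructure {x : V | in_FM x}
    (fun x y => aeq (sval x) (sval y))
    (fun x y => amem (sval x) (sval y))
    (fun x => is_set (sval x)).

Lemma aeq_refl x : aeq x x.
Proof. by elim: x => //= T f IH; split=> i; exists i. Qed.

Lemma aeq_sym x y : aeq x y -> aeq y x.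
Proof.
elim: x y => [u|P f IH] [v|T g] //= [fg gf]; split=> i.
- by have [j /IH] := gf i; exists j.
- by have [j /IH] := fg i; exists j.
Qed.

Lemma aeq_trans y x z : aeq x y -> aeq y z -> aeq x z.
Proof.
elim: x y z => [u|P f IH] [v|T g] [w|R h] //=; first by move=> ->.
move=> [fg gf] [gh hg]; split=> i.
- by have [j /IH fj] := fg i; have [k /fj] := gh j; exists k.
- by have [j gj] := hg i; have [k /IH fk] := gf j; exists k; apply: fk.
Qed.

Lemma aeq_act g x y : aeq x y -> aeq (aact g x) (aact g y).
Proof.
elim: x y => [u|P f IH] [v|T h] //=; first by move=> ->.
by move=> [fh hf]; split=> i; [have [j] := fh i | have [j] := hf i];
  exists j; apply: IH.
Qed.

Lemma aact_comp g h x : aact (g \o h) x = aact g (aact h x).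
Proof. by elim: x => //= T f IH; congr Sup; apply/funext. Qed.

Lemma aact_id x : aact id x = x.
Proof. by elim: x => //= T f IH; congr Sup; apply/funext. Qed.

Lemma setwise_stab_group x : perm_group_axiom (setwise_stab x).
Proof.
have [Gbij Gid Gcomp Ginv] := pg_axiom G; split.
- by move=> g [/Gbij].
- by split=> //; rewrite aact_id; apply: aeq_refl.
- move=> g h [Gg gx] [Gh hx]; split; first exact: Gcomp.
  by rewrite aact_comp; apply: aeq_trans gx; apply: aeq_act.
- move=> g h [Gg gx] gh hg; split; first exact: Ginv Gg gh hg.
  apply: aeq_trans (aeq_act h (aeq_sym gx)) _.
  by rewrite -aact_comp (_ : h \o g = id) ?aact_id; [exact: aeq_refl
    | apply/funext].
Qed.

Lemma in_FM_atom u : in_FM (Atom u).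
Proof.
split=> //; split; [exact: setwise_stab_group | by move=> g [] |].
by exists [set u] => [|g [Gg gu]]; [exact: finite_set1 | split=> //=; apply: gu].
Qed.

Lemma in_FM_atoms : in_FM atoms.
Proof.
apply: InFM; last first.
  move=> [v _|T f]; first exact: in_FM_atom.
  by case=> u vu; case: vu.
split; [exact: setwise_stab_group | by move=> g [] |].
exists set0 => [|g [Gg _]]; first exact: finite_set0.
split=> //=; split=> [u|u]; first by exists (g u).
have [Gbij _ _ _] := pg_axiom G; have [h _ hg] := Gbij g Gg.
by exists (h u); rewrite hg.
Qed.

Definition FM_atoms : FM := exist _ atoms in_FM_atoms.

End FraenkelMostowski.

(** * The tree of atoms and its automorphism group *)

Section Tree.
Variable X : nat -> Type.

(* Finite sequences (x_i : i < n) with x_i \in X_i, for varying n *)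
Definition tree : Type := {n : nat & forall i : 'I_n, X i}.

Definition tree_length (t : tree) : nat := tag t.

Definition extends (s t : tree) (lt_st : tree_length s < tree_length t) :
    Prop :=
  forall i : 'I_(tree_length s),
    tagged t (widen_ord (ltnW lt_st) i) = tagged s i.

(* For s of length n, g acts on the entry of index n (the (n+1)-th entry) of
   every sequence properly extending s. *)
Definition node_act (s : tree) (g : X (tree_length s) -> X (tree_length s))
    (t : tree) : tree :=
  match @idP (tree_length s < tree_length t) with
  | ReflectT lt_st =>
      if `[< extends lt_st >] then
        Tagged (fun n => forall i : 'I_n, X i)
          (dfwith (T := fun i : 'I_(tree_length t) => X i) (tagged t)
             (i := Ordinal lt_st) (g (tagged t (Ordinal lt_st))))
      else t
  | ReflectF _ => t
  end.

Lemma node_act_short s g t :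
  ~~ (tree_length s < tree_length t) -> @node_act s g t = t.
Proof.
by rewrite /node_act; case: {-}_ / idP => // lt_st; rewrite lt_st.
Qed.

Lemma node_act_out s g t (lt_st : tree_length s < tree_length t) :
  ~ extends lt_st -> @node_act s g t = t.
Proof.
move=> est; rewrite /node_act; case: {-}_ / idP => // lt_st'.
by rewrite (bool_irrelevance lt_st' lt_st) asboolF.
Qed.

Lemma node_act_in s g t (lt_st : tree_length s < tree_length t) :
  extends lt_st ->
  @node_act s g t = Tagged (fun n => forall i : 'I_n, X i)
          (dfwith (T := fun i : 'I_(tree_length t) => X i) (tagged t)
             (i := Ordinal lt_st) (g (tagged t (Ordinal lt_st)))).
Proof.
move=> est; rewrite /node_act; case: {-}_ / idP => [lt_st'|/(_ lt_st)//].
by rewrite (bool_irrelevance lt_st' lt_st) asboolT.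
Qed.

Lemma node_actK s g h : cancel g h -> cancel (@node_act s g) (node_act h).
Proof.
move=> gh t; have [lt_st|le_ts] := boolP (tree_length s < tree_length t); last first.
  by rewrite !(node_act_short _ le_ts).
have [est|nest] := pselect (extends lt_st); last by rewrite !(node_act_out _ nest).
rewrite (node_act_in g est) (@node_act_in _ _ (Tagged _ _) lt_st); last first.
  move=> i; rewrite /= dfwith_out ?est// -val_eqE /= gtn_eqF//.
case: t lt_st est => n t /= lt_st est; congr Tagged.
apply/functional_extensionality_dep => i; rewrite dfwith_in gh.
by case: dfwithP => // j nj; rewrite dfwith_out.
Qed.

Variable G : forall n, perm_group (X n).

Definition node_actions : set (tree -> tree) :=
  [set f | exists s : tree, exists2 g, pg_set (G (tree_length s)) g
                                     & f = node_act g].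

(* The group generated by the node actions *)
Definition tree_group_set : set (tree -> tree) :=
  smallest (@perm_group_axiom tree) node_actions.

Lemma node_actions_bij f : node_actions f -> bijective f.
Proof.
move=> [s [g Gg ->]]; have [Gbij _ _ _] := pg_axiom (G (tree_length s)).
have [h gh hg] := Gbij g Gg.
by exists (@node_act s h); apply: node_actK.
Qed.

Lemma tree_group_axiom : perm_group_axiom tree_group_set.
Proof.
split.
- move=> f; apply; split; last exact: node_actions_bij.
  split=> // [|g h bg bh|g h _ gh hg]; first by exists id.
  + exact: bij_comp bg bh.
  + by exists g.
- by move=> H [[]].
- by move=> g h Gg Gh H HG; have [[_ _ Hcomp _] _] := HG;
    apply: Hcomp; [apply: Gg | apply: Gh].
- by move=> g h Gg gh hg H HG; have [[_ _ _ Hinv] _] := HG;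
    apply: (Hinv g) => //; apply: Gg.
Qed.

Definition tree_group : perm_group tree := PermGroup tree_group_axiom.

End Tree.

(* Main.v *)
From Stdlib Require Import Eqdep_dec.
Require Import Defs.
From mathcomp Require Import all_boot.
From mathcomp Require Import boolp classical_sets functions cardinality.

Local Open Scope classical_set_scope.
Local Open Scope card_scope.

Set Implicit Arguments.
Unset Strict Implicit.
Unset Printing Implicit Defensive.

(** The proof has two independent halves.

    In any Fraenkel-Mostowski model with finite supports, the set of atoms has
    its cardinality in Delta if and only if definable closure is locally finite
    for the group acting on the atoms ([atoms_in_DeltaP]). A sequence in the
    model has a finite support, and because natural numbers are fixed by every
    permutation, this support fixes each term of the sequence separately. So an
    injective sequence of atoms exhibits an infinite definable closure of a
    finite set. Conversely, any enumeration of infinitely many points of such a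
    closure is supported by the finite set, hence lies in the model; composed
    with a bijection of the model, which has a finite support too, it also
    refutes Dedekind finiteness of every set equinumerous with the atoms.

    What remains is to compare definable closure in the tree with definable
    closure in each [X n]. If [dcl] is infinite for some [G n], it is infinite
    among the children of any fixed node of length [n], because the stabilizer
    of the node acts on its children through [G n] ([tree_dcl_children]).
    If [dcl] is locally finite for all the [G n], a node definable over a finite
    set [E] of nodes is the root, or a child of a proper initial segment of an
    element of [E], and its last entry is definable in [X n] over the entries of
    index [n] of [E]; this leaves finitely many nodes ([tree_dcl_finite]). *)

(** * Countably infinite subsets *)

Lemma infinite_set_injP T (A : set T) : infinite_set A <->
  exists2 x : nat -> T, injective x & forall k, A (x k).
Proof.
elim/Ppointed: T => T in A *.
  rewrite emptyE; split=> [/(_ (finite_set0 _))//|[x _ xA]].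
  by have := xA 0.
rewrite infiniteP; split=> [/pcard_leP/injfunPex[x xA xinj]|[x xinj xA]].
  by exists x => [j k|k]; [apply: xinj; rewrite inE|apply: xA].
by apply/pcard_leP/injfunPex; exists x => [k _|j k _ _ /xinj].
Qed.

(** * Pairs and numerals in the cumulative hierarchy over atoms *)

Section AtomicSets.
Variable U : Type.
Local Notation V := (atomic_set U).
Implicit Types x y z a b c d : V.

Lemma amem_aeql x y z : aeq x y -> amem y z -> amem x z.
Proof.
by case: z => // T f xy [i yi]; exists i; apply: aeq_trans yi.
Qed.

Lemma amem_aeqr x y z : aeq x y -> amem z x -> amem z y.
Proof.
case: x y => [u|T f] [v|S g] //= [fg _] [i zi].
by have [j ij] := fg i; exists j; apply: aeq_trans ij.
Qed.

Lemma is_set_aeq x y : aeq x y -> is_set x -> is_set y.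
Proof. by case: x y => [u|T f] [v|S g]. Qed.

Lemma amem_act g x y : amem y x -> amem (aact g y) (aact g x).
Proof. by case: x => //= T f [i yi]; exists i; apply: aeq_act. Qed.

Lemma aeq_ext x y : is_set x -> is_set y ->
  (forall z, amem z x -> amem z y) -> (forall z, amem z y -> amem z x) ->
  aeq x y.
Proof.
case: x y => [u|T f] [v|S g] //= _ _ xy yx; split=> i.
  by apply: xy; exists i; apply: aeq_refl.
have [j ij] : exists j, aeq (g i) (f j) by apply: yx; exists i; apply: aeq_refl.
by exists j; apply: aeq_sym.
Qed.

Lemma amem_irrefl x : ~ amem x x.
Proof.
elim: x => [u|T f IH]; first by case.
move=> [i xi]; apply: (IH i).
by apply: amem_aeqr xi _; exists i; apply: aeq_refl.
Qed.

Definition upair a b : V := Sup (fun c : bool => if c then a else b).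
Definition kpair a b : V := upair (upair a a) (upair a b).

Lemma amem_upair z a b : amem z (upair a b) <-> aeq z a \/ aeq z b.
Proof.
split=> [[[] zi]|[za|zb]]; [by left|by right| |].
- by exists true.
- by exists false.
Qed.

Lemma aeq_upair a b c d : aeq a c -> aeq b d -> aeq (upair a b) (upair c d).
Proof.
move=> ac bd.
by split; case; [exists true|exists false|exists true|exists false].
Qed.

Lemma aeq_kpair a b c d : aeq a c -> aeq b d -> aeq (kpair a b) (kpair c d).
Proof. by move=> ac bd; do 2?apply: aeq_upair. Qed.

Lemma aact_upair g a b : aact g (upair a b) = upair (aact g a) (aact g b).
Proof. by congr Sup; apply/funext; case. Qed.

Lemma aact_kpair g a b : aact g (kpair a b) = kpair (aact g a) (aact g b).
Proof. by rewrite /kpair !aact_upair. Qed.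

Lemma upair_singleton_inj a b c : aeq (upair a b) (upair c c) ->
  aeq a c /\ aeq b c.
Proof.
have mem z : aeq (upair a b) (upair c c) -> amem z (upair a b) -> aeq z c.
  by move=> /amem_aeqr/[apply]/amem_upair[].
move=> E; split; apply: mem E _; apply/amem_upair.
  by left; apply: aeq_refl.
by right; apply: aeq_refl.
Qed.

Lemma upair_injr a b c d : aeq a c -> aeq (upair a b) (upair c d) -> aeq b d.
Proof.
move=> ac E.
have /(amem_aeqr E)/amem_upair : amem b (upair a b).
  by apply/amem_upair; right; apply: aeq_refl.
case=> // bc.
have /(amem_aeqr (aeq_sym E))/amem_upair : amem d (upair c d).
  by apply/amem_upair; right; apply: aeq_refl.
case=> [da|/aeq_sym//].
exact: aeq_trans bc (aeq_trans (aeq_sym ac) (aeq_sym da)).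
Qed.

(** Membership of [{a}] in [{{c}, {c, d}}] yields [a = c]; the second
    coordinates then follow by cancelling a common element of unordered pairs
    twice, which avoids a case analysis on [a = b]. *)
Lemma kpair_inj a b c d : aeq (kpair a b) (kpair c d) -> aeq a c /\ aeq b d.
Proof.
move=> E; have ac : aeq a c.
  have /(amem_aeqr E)/amem_upair : amem (upair a a) (kpair a b).
    by apply/amem_upair; left; apply: aeq_refl.
  case=> [/upair_singleton_inj[]//|/aeq_sym/upair_singleton_inj[/aeq_sym//]].
split=> //; apply: (upair_injr ac).
apply: (upair_injr _ E); exact: aeq_upair.
Qed.

Definition succ x : V :=
  if x is Sup T f then Sup (fun o : option T => if o is Some i then f i else x)
  else x.

(** The von Neumann numerals. *)
Fixpoint num k : V := if k is k'.+1 then succ (num k') else Sup (False_rect V).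

Lemma num_set k : is_set (num k).
Proof. by elim: k => //= k; case: (num k). Qed.

Lemma amem_succ x z : is_set x -> amem z (succ x) <-> amem z x \/ aeq z x.
Proof.
case: x => // T f _; split=> [[[i|] zi]|[[i zi]|zx]].
- by left; exists i.
- by right.
- by exists (Some i).
- by exists None.
Qed.

(** A set without atoms in its transitive closure is not moved by permutations
    of the atoms. Hence a support of a sequence is a support of each term. *)
Lemma aact_num g k : aact g (num k) = num k.
Proof.
elim: k => [|k IH] /=; first by congr Sup; apply/funext.
rewrite -{2}IH; case: (num k) => //= T f; congr Sup.
by apply/funext; case.
Qed.

Lemma amem_num j k : (j < k)%N -> amem (num j) (num k).
Proof.
elim: k => // k IH; rewrite ltnS leq_eqVlt => /orP[/eqP->|/IH jk].
  by apply/amem_succ; [exact: num_set|right; apply: aeq_refl].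
by apply/amem_succ; [exact: num_set|left].
Qed.

Lemma num_inj j k : aeq (num j) (num k) -> j = k.
Proof.
move=> jk; case: (ltngtP j k) => // /amem_num.
- by move=> /(amem_aeqr (aeq_sym jk))/amem_irrefl.
- by move=> /(amem_aeqr jk)/amem_irrefl.
Qed.

End AtomicSets.

(** * Absoluteness in Fraenkel-Mostowski models *)

Section FM.
Variables (U : Type) (G : perm_group U).
Local Notation V := (atomic_set U).
Implicit Types (x y z a b : V) (A : set U).

(** The model is transitive, so quantifying over it loses no element of its
    sets. *)
Lemma in_FM_mem x y : in_FM G x -> amem y x -> in_FM G y.
Proof. by case=> _; apply. Qed.

Lemma in_FM_aeq x y : aeq x y -> in_FM G x -> in_FM G y.
Proof.
move=> xy [[_ _ [A finA Ax]] FMx]; apply: InFM; last first.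
  by move=> z zy; apply: FMx; apply: amem_aeqr (aeq_sym xy) zy.
split; [exact: setwise_stab_group | by move=> g [] |].
exists A => // g Ag; have [Gg gx] := Ax g Ag; split=> //.
exact: aeq_trans (aeq_act g (aeq_sym xy)) (aeq_trans gx xy).
Qed.

Definition supports A x :=
  forall g, pointwise_stab G A g -> aeq (aact g x) x.

Lemma supports_sub A B x : A `<=` B -> supports A x -> supports B x.
Proof. by move=> AB Ax g [Gg gB]; apply: Ax; split=> // a /AB/gB. Qed.

Lemma in_FM_support x : in_FM G x -> exists2 A, finite_set A & supports A x.
Proof. by case=> -[_ _ [A finA Ax]] _; exists A => // g /Ax[]. Qed.

(** The way in which all sets of the model are built below: a family from
    the model whose range, as a whole, has a finite support. *)
Lemma in_FM_Sup T (f : T -> V) A :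
  finite_set A -> supports A (Sup f) -> (forall i, in_FM G (f i)) ->
  in_FM G (Sup f).
Proof.
move=> finA Af FMf; apply: InFM; last first.
  by move=> y [i yi]; apply: in_FM_aeq (aeq_sym yi) (FMf i).
split; [exact: setwise_stab_group | by move=> g [] |].
by exists A => // g Ag; split; [case: Ag | exact: Af].
Qed.

Lemma supports_Sup T (f : T -> V) A :
  (forall i, supports A (f i)) -> supports A (Sup f).
Proof. by move=> Af g Ag; split=> i; exists i; apply: Af. Qed.

Lemma supports_upair A a b :
  supports A a -> supports A b -> supports A (upair a b).
Proof. by move=> Aa Ab; apply: supports_Sup; case. Qed.

Lemma supports_kpair A a b :
  supports A a -> supports A b -> supports A (kpair a b).
Proof. by move=> Aa Ab; do 2?apply: supports_upair. Qed.

Lemma in_FM_upair a b : in_FM G a -> in_FM G b -> in_FM G (upair a b).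
Proof.
move=> FMa FMb; have [A finA Aa] := in_FM_support FMa.
have [B finB Bb] := in_FM_support FMb.
apply: (@in_FM_Sup _ _ (A `|` B)); [by rewrite finite_setU| |by case].
apply: supports_upair; first by apply: supports_sub Aa => z; left.
by apply: supports_sub Bb => z; right.
Qed.

Lemma in_FM_kpair a b : in_FM G a -> in_FM G b -> in_FM G (kpair a b).
Proof. by move=> FMa FMb; do 2?apply: in_FM_upair. Qed.

Lemma in_FM_kpairr a b : in_FM G (kpair a b) -> in_FM G b.
Proof.
move=> FMab; apply: (@in_FM_mem (upair a b)).
  by apply: in_FM_mem FMab _; apply/amem_upair; right; apply: aeq_refl.
by apply/amem_upair; right; apply: aeq_refl.
Qed.

Lemma in_FM_num k : in_FM G (num U k).
Proof.
elim: k => [|k IH] /=.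
  by apply: (@in_FM_Sup _ _ set0) => //; apply: supports_Sup.
have {IH} : in_FM G (num U k) /\ supports set0 (num U k.+1).
  by split=> // g _; rewrite aact_num; apply: aeq_refl.
rewrite /=; case: (num U k) => [u [] //|T f [FMf sf]].
apply: (in_FM_Sup (finite_set0 _) sf) => -[i|//].
by apply: in_FM_mem FMf _; exists i; apply: aeq_refl.
Qed.

Lemma in_FM_omega : in_FM G (Sup (@num U)).
Proof.
apply: (in_FM_Sup (finite_set0 _)); last exact: in_FM_num.
by apply: supports_Sup => k g _; rewrite aact_num; apply: aeq_refl.
Qed.

Implicit Types p f u v : FM G.

(** Extensionality inside the model agrees with extensional equality outside,
    by transitivity of the model. This makes the notions of set theory that
    follow absolute. *)
Lemma FM_ext p f : is_set (sval p) -> is_set (sval f) ->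
  (forall z : FM G, st_mem z p <-> st_mem z f) -> aeq (sval p) (sval f).
Proof.
move=> sp sf pf; apply: aeq_ext => // z zp.
  by have /(_ zp) := proj1 (pf (exist _ z (in_FM_mem (svalP p) zp))).
by have /(_ zp) := proj2 (pf (exist _ z (in_FM_mem (svalP f) zp))).
Qed.

Lemma FM_unordered_pairP p u v :
  st_unordered_pair p u v <-> aeq (sval p) (upair (sval u) (sval v)).
Proof.
split=> [[sp pE]|pE].
  apply: (@FM_ext p (exist _ _ (in_FM_upair (svalP u) (svalP v)))) => // z.
  by rewrite pE; symmetry; apply: amem_upair.
split; first exact: is_set_aeq (aeq_sym pE) _.
move=> z; rewrite -[_ \/ _]/(aeq _ _ \/ aeq _ _) -amem_upair.
by split; apply: amem_aeqr => //; apply: aeq_sym.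
Qed.

Lemma FM_pairP p u v :
  st_pair p u v <-> aeq (sval p) (kpair (sval u) (sval v)).
Proof.
split=> [[s [d [/FM_unordered_pairP sE /FM_unordered_pairP dE
  /FM_unordered_pairP pE]]]|pE].
  by apply: aeq_trans pE _; apply: aeq_upair.
exists (exist _ _ (in_FM_upair (svalP u) (svalP u))).
exists (exist _ _ (in_FM_upair (svalP u) (svalP v))).
split; apply/FM_unordered_pairP; [exact: aeq_refl|exact: aeq_refl|exact: pE].
Qed.

Lemma FM_mapsP f u v :
  st_maps f u v <-> amem (kpair (sval u) (sval v)) (sval f).
Proof.
split=> [[p /FM_pairP pE pf]|abf]; first exact: amem_aeql (aeq_sym pE) pf.
exists (exist _ _ (in_FM_kpair (svalP u) (svalP v))) => //.
by apply/FM_pairP; apply: aeq_refl.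
Qed.

(** A function of the model, applied to a point, gives a value supported by
    any common support of the function and the point. The conjugate pair
    [(g u, g v)] lies in [f], and so does [(u, g v)]; hence functionality of [f]
    at [u] identifies [g v] with [v]. *)
Lemma FM_maps_fixed f u v g :
  (forall c, st_maps f u v -> st_maps f u c -> st_eq v c) ->
  aeq (aact g (sval f)) (sval f) -> aeq (aact g (sval u)) (sval u) ->
  st_maps f u v -> aeq (aact g (sval v)) (sval v).
Proof.
move=> func gf ga fab; have /FM_mapsP abf := fab.
have agbf : amem (kpair (sval u) (aact g (sval v))) (sval f).
  apply: amem_aeqr gf _; apply: amem_aeql (amem_act g abf).
  by rewrite aact_kpair; apply: aeq_kpair; [apply: aeq_sym|apply: aeq_refl].
(* [g v] lies in the model because it is a coordinate of an element of [f],
   without conjugating supports. *)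
have FMgb := in_FM_kpairr (in_FM_mem (svalP f) agbf).
by apply: aeq_sym; apply: (func (exist _ _ FMgb)) => //; apply/FM_mapsP.
Qed.

(** Two families with matching coincidences have equinumerous ranges in the
    model as soon as the graph of the correspondence has a finite support. *)
Lemma FM_graph_equinumerous T (a b : T -> V)
    (FMa : in_FM G (Sup a)) (FMb : in_FM G (Sup b)) :
  in_FM G (Sup (fun i => kpair (a i) (b i))) ->
  (forall i j, aeq (a i) (a j) <-> aeq (b i) (b j)) ->
  st_equinumerous (exist _ _ FMa : FM G) (exist _ _ FMb : FM G).
Proof.
move=> FMf abE; exists (exist _ _ FMf).
have FMai i : in_FM G (a i).
  by apply: in_FM_mem FMa _; exists i; apply: aeq_refl.
have FMbi i : in_FM G (b i).
  by apply: in_FM_mem FMb _; exists i; apply: aeq_refl.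
split=> //.
- move=> p [i pi]; exists (exist _ _ (FMai i)), (exist _ _ (FMbi i)); split.
  + by exists i; apply: aeq_refl.
  + by exists i; apply: aeq_refl.
  + exact/FM_pairP.
- move=> x [i xi]; split.
    exists (exist _ _ (FMbi i)); apply/FM_mapsP; exists i.
    by apply: aeq_kpair => //; apply: aeq_refl.
  move=> y y' /FM_mapsP[j /kpair_inj[xj yj]] /FM_mapsP[k /kpair_inj[xk yk]].
  apply: aeq_trans yj _; apply: aeq_trans (aeq_sym yk).
  by apply/abE; apply: aeq_trans (aeq_sym xj) xk.
- move=> x [i xi]; split.
    exists (exist _ _ (FMai i)); apply/FM_mapsP; exists i.
    by apply: aeq_kpair => //; apply: aeq_refl.
  move=> y y' /FM_mapsP[j /kpair_inj[yj xj]] /FM_mapsP[k /kpair_inj[yk xk]].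
  apply: aeq_trans yj _; apply: aeq_trans (aeq_sym yk).
  by apply/abE; apply: aeq_trans (aeq_sym xj) xk.
Qed.

Lemma FM_inductive_num (w : FM G) :
  st_inductive w -> forall k, amem (num U k) (sval w).
Proof.
case=> sw [e [se e0] ew] wS; elim=> [|k IH].
  apply: amem_aeql ew; apply: aeq_ext => //.
    by move=> z [].
  by move=> z ze; have := e0 (exist _ z (in_FM_mem (svalP e) ze)).
have [s [ss sE] sw'] := wS (exist _ _ (in_FM_num k)) IH.
apply: amem_aeql sw'.
apply: (@FM_ext (exist _ _ (in_FM_num k.+1)) s) => //; first exact: num_set.
by move=> z; rewrite sE; apply: amem_succ; apply: num_set.
Qed.

Lemma FM_omega : st_omega (exist _ _ in_FM_omega : FM G).
Proof.
split; last first.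
  move=> w' ind; split=> // z [k zk]; apply: amem_aeql zk _.
  exact: FM_inductive_num.
split=> //.
  exists (exist _ _ (in_FM_num 0)); last by exists 0; apply: aeq_refl.
  by split=> // z [].
move=> x [k xk]; exists (exist _ _ (in_FM_num k.+1)).
  split; first exact: num_set.
  move=> z; rewrite /= (amem_succ _ (num_set _ k)); split=> -[zx|zx].
  - by left; apply: amem_aeqr (aeq_sym xk) zx.
  - by right; apply: aeq_trans zx (aeq_sym xk).
  - by left; apply: amem_aeqr xk zx.
  - by right; apply: aeq_trans zx xk.
by exists k.+1; apply: aeq_refl.
Qed.

End FM.

(** * Dedekind finiteness of the atoms and definable closure *)

Section DedekindFinite.
Variables (U : Type) (G : perm_group U).

(** A bijection is a set of pairs that satisfy [st_pair] up to equality, so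
    membership of the value in the codomain goes through injectivity of
    pairs. *)
Lemma FM_bijection_mem (f A B a b : FM G) :
  st_bijection f A B -> st_maps f a b -> amem (sval b) (sval B).
Proof.
move=> [_ fAB _ _] [p /FM_pairP pab pf].
have [a' [b' [_ b'B /FM_pairP pab']]] := fAB p pf.
by have [_ /amem_aeql] := kpair_inj (aeq_trans (aeq_sym pab) pab'); apply.
Qed.

(** An enumeration [f] of atoms in the model has a finite support [E]. Since
    the numerals are fixed by all permutations, the enumerated atoms are fixed
    by the pointwise stabilizer of [E], and so they are infinitely many points
    of the definable closure of [E]. *)
Lemma atoms_dedekind_finite :
  dcl_locally_finite G -> st_dedekind_finite (FM_atoms G).
Proof.
move=> Gfin; split=> // -[B [_ Batoms] [w [wind _] [f fbij]]].
have [_ _ fw fB] := fbij.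
have [E finE Ef] := in_FM_support (svalP f).
pose n k : FM G := exist _ _ (in_FM_num G k).
have nw k : st_mem (n k) w := FM_inductive_num wind k.
have /choice[x xP] k : exists x, amem (kpair (num U k) (Atom x)) (sval f).
  have [[b fkb] _] := fw _ (nw k).
  have /(Batoms b)[x bx] := FM_bijection_mem fbij fkb.
  have /FM_mapsP kbf := fkb; exists x; apply: amem_aeql kbf.
  by apply: aeq_kpair; [apply: aeq_refl|apply: aeq_sym].
pose u k : FM G := exist _ _ (in_FM_atom G (x k)).
have fnu k : st_maps f (n k) (u k) by apply/FM_mapsP; apply: xP.
apply: (infinite_set_injP _).2 (Gfin _ finE); exists x.
  move=> j k xjk; apply: (@num_inj U).
  have uB : st_mem (u k) B := FM_bijection_mem fbij (fnu k).
  have [_ uinj] := fB _ uB; apply: (uinj (n j) (n k)) => //.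
  by apply/FM_mapsP; rewrite /= -xjk; apply: xP.
move=> k g /Ef gf; have [_ func] := fw _ (nw k).
apply: (FM_maps_fixed (func _) gf _ (fnu k)).
by rewrite aact_num; apply: aeq_refl.
Qed.

Lemma FM_atoms_equinumerous_refl :
  st_equinumerous (FM_atoms G) (FM_atoms G).
Proof.
apply: (@FM_graph_equinumerous _ _ _ (@Atom U) (@Atom U) (in_FM_atoms G)
  (in_FM_atoms G)); last by [].
apply: (in_FM_Sup (finite_set0 _)) => [g [Gg _]|u]; last first.
  by apply: in_FM_kpair; apply: in_FM_atom.
have [Gbij _ _ _] := pg_axiom G; have [h _ hK] := Gbij g Gg.
split=> [u|u]; [exists (g u)|exists (h u)]; rewrite aact_kpair.
  exact: (aeq_refl (kpair _ _)).
by rewrite -[in X in aeq _ X](hK u); exact: (aeq_refl (kpair _ _)).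
Qed.

(** The atoms [x k] of an infinite definable closure over [A] have a common
    support [A], so a sequence of them belongs to the model. Its image under a
    bijection [f] from the atoms to [D] is supported by [A] together with a
    support of [f], which makes [D] Dedekind infinite. *)
Lemma infinite_dcl_not_Delta A :
  finite_set A -> infinite_set (dcl G A) -> ~ card_in_Delta (FM_atoms G).
Proof.
move=> finA /infinite_set_injP[x xinj xdcl] [D [_ Dfin] [f fbij]].
have [_ _ fatoms fD] := fbij.
have [E finE Ef] := in_FM_support (svalP f).
pose u k : FM G := exist _ _ (in_FM_atom G (x k)).
have uU k : st_mem (u k) (FM_atoms G) by exists (x k).
have /choice[b fub] k : exists b, st_maps f (u k) b.
  by have [] := fatoms _ (uU k).
have bsupp k : supports G (E `|` A) (sval (b k)).
  move=> g [Gg gEA]; have [_ func] := fatoms _ (uU k).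
  apply: (FM_maps_fixed (func _) _ _ (fub k)).
    by apply: Ef; split=> // e Ee; apply: gEA; left.
  by rewrite /= xdcl//; split=> // a Aa; apply: gEA; right.
have finEA : finite_set (E `|` A) by rewrite finite_setU.
have FMB : in_FM G (Sup (fun k => sval (b k))).
  by apply: (in_FM_Sup finEA); [apply: supports_Sup|move=> k; apply: svalP].
apply: Dfin; exists (exist _ _ FMB).
  split=> // z [k zk]; apply: amem_aeql zk _.
  exact: FM_bijection_mem fbij (fub k).
exists (exist _ _ (in_FM_omega G)); first exact: FM_omega.
apply: (FM_graph_equinumerous (in_FM_omega G) FMB).
  apply: (in_FM_Sup finEA); last first.
    by move=> k; apply: in_FM_kpair; [apply: in_FM_num|apply: svalP].
  apply: supports_Sup => k; apply: supports_kpair => // g _.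
  by rewrite aact_num; apply: aeq_refl.
move=> j k; split=> [/num_inj->|bjk]; first exact: aeq_refl.
have bD : st_mem (b k) D := FM_bijection_mem fbij (fub k).
have [_ /(_ (u j) (u k))] := fD _ bD.
suff fujbk : st_maps f (u j) (b k).
  by move=> /(_ fujbk (fub k)) /xinj->; apply: aeq_refl.
apply/FM_mapsP; have /FM_mapsP := fub j; apply: amem_aeql.
by apply: aeq_kpair; [apply: aeq_refl|apply: aeq_sym].
Qed.

Lemma atoms_in_DeltaP :
  card_in_Delta (FM_atoms G) <-> dcl_locally_finite G.
Proof.
split=> [Delta A finA|Gfin].
  by apply: contrapT => infA; apply: infinite_dcl_not_Delta finA infA Delta.
exists (FM_atoms G); first exact: atoms_dedekind_finite.
exact: FM_atoms_equinumerous_refl.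
Qed.

End DedekindFinite.

(** * Definable closure in the tree *)

Section Tree.
Variables (X : nat -> Type) (G : forall n, perm_group (X n)).
Local Notation tree := (tree X).
Implicit Types (v w : forall n, X n) (s t : tree).

(** Nodes of the tree are presented as truncations of infinite sequences, so
    that sequences of different lengths are compared and modified entrywise
    without transporting entries along equalities of lengths. *)
Definition truncate w n : tree :=
  Tagged (fun n => forall i : 'I_n, X i) (fun i : 'I_n => w i).

Lemma truncateP v w m n : truncate v m = truncate w n <->
  m = n /\ forall i, (i < n)%N -> v i = w i.
Proof.
split=> [E|[-> vw]]; last first.
  by congr Tagged; apply/functional_extensionality_dep => i; apply: vw.
have mn : m = n := congr1 (@tree_length X) E.
split=> //; subst m => i lt_in.
have vw := inj_pair2_eq_dec _ (@eq_comparable nat) _ _ _ _ E.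
exact: (congr1 (@^~ (Ordinal lt_in)) vw).
Qed.

Lemma truncate_surj w0 t : exists v n, t = truncate v n.
Proof.
case: t => n f /=.
exists (fun i =>
  if @idP (i < n)%N is ReflectT lt then f (Ordinal lt) else w0 i), n.
congr existT; apply/functional_extensionality_dep => -[i lt_in] /=.
case: {-}_ / idP => // lt_in'.
by rewrite (bool_irrelevance lt_in' lt_in).
Qed.

Lemma node_act_truncate v m (g : X m -> X m) w n :
  (m < n)%N -> (forall i, (i < m)%N -> v i = w i) ->
  @node_act X (truncate v m) g (truncate w n) = truncate (dfwith w (g (w m))) n.
Proof.
move=> lt_mn vw.
rewrite (@node_act_in _ (truncate v m) g (truncate w n) lt_mn); last first.
  by move=> i; rewrite /= vw.
congr Tagged; apply/functional_extensionality_dep => i /=.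
case: dfwithP => [|j]; first by rewrite dfwith_in.
by rewrite -val_eqE /= => mj; rewrite dfwith_out.
Qed.

Lemma node_act_truncate_out v m (g : X m -> X m) w n :
  ~ ((m < n)%N /\ (forall i, (i < m)%N -> v i = w i)) ->
  @node_act X (truncate v m) g (truncate w n) = truncate w n.
Proof.
move=> nvw; have [lt_mn|ge_mn] := boolP (m < n)%N; last exact: node_act_short.
apply: (@node_act_out _ (truncate v m) g (truncate w n) lt_mn) => ext.
apply: nvw; split=> // i lt_im; symmetry.
exact: ext (Ordinal lt_im).
Qed.

Lemma node_act_tree_group v m (g : X m -> X m) :
  pg_set (G m) g -> pg_set (tree_group G) (@node_act X (truncate v m) g).
Proof. by move=> Gg; apply: sub_gen_smallest; exists (truncate v m), g. Qed.

(** Overwriting the entry of index [n] lets all the children of a node be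
    described by one infinite sequence [w], of which only the entries before
    index [n] matter ([child_eq]). *)
Definition child w n (x : X n) : tree := truncate (dfwith w x) n.+1.

Lemma child_inj w n : injective (@child w n).
Proof.
by move=> x y /truncateP[_ /(_ n (leqnn _))]; rewrite !dfwith_in.
Qed.

Lemma child_eq v w n x : (forall i, (i < n)%N -> v i = w i) ->
  @child v n x = child w x.
Proof.
move=> vw; apply/truncateP; split=> // i; rewrite ltnS leq_eqVlt.
move=> /orP[/eqP->|lt_in]; first by rewrite !dfwith_in.
by rewrite !dfwith_out ?vw// gtn_eqF.
Qed.

Definition acts_on_children (f : tree -> tree) :=
  forall w n, exists v, exists2 h, pg_set (G n) h &
    f (truncate w n) = truncate v n /\
    forall x : X n, f (child w x) = child v (h x).

(** A node action at [s] permutes the children of [s] by its own permutation.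
    Every other node has its children either all fixed, or all moved by a
    change of an earlier entry, which leaves the last entries alone. *)
Lemma node_act_children s g : pg_set (G (tree_length s)) g ->
  acts_on_children (@node_act X s g).
Proof.
move=> Gg w n; move: g Gg; have [v [m ->]] := truncate_surj w s => g /= Gg.
have [_ Gid _ _] := pg_axiom (G n).
have [[le_mn vw]|nvw] := pselect
  ((m <= n)%N /\ forall i, (i < m)%N -> v i = w i); last first.
  exists w, id => //; split=> [|x]; apply: node_act_truncate_out => -[lt_mn vw].
    by apply: nvw; split=> //; apply: ltnW.
  apply: nvw; split=> // i lt_im; rewrite vw// dfwith_out//.
  by rewrite gtn_eqF// (leq_trans lt_im).
move: le_mn; rewrite leq_eqVlt => /orP[/eqP mn|lt_mn].
  subst m; exists w, g => //; split=> [|x].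
    by apply: node_act_truncate_out => -[]; rewrite ltnn.
  rewrite node_act_truncate// => [|i lt_in]; last first.
    by rewrite dfwith_out ?vw// gtn_eqF.
  rewrite dfwith_in; apply: (@child_eq (dfwith w x)) => i lt_in.
  by rewrite dfwith_out// gtn_eqF.
exists (dfwith w (g (w m))), id => //; split=> [|x].
  exact: node_act_truncate.
rewrite node_act_truncate ?ltnS ?(ltnW lt_mn)// => [|i lt_im]; last first.
  by rewrite dfwith_out ?vw// gtn_eqF// (ltn_trans lt_im).
apply/truncateP; split=> // i _.
have nm : n != m by rewrite gtn_eqF.
rewrite (@dfwith_out _ X w n x m nm).
have [<-|ni] := eqVneq n i; first by rewrite dfwith_out 1?eq_sym// !dfwith_in.
rewrite (@dfwith_out _ _ _ n x i ni).
have [<-|mi] := eqVneq m i; first by rewrite !dfwith_in.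
by rewrite !dfwith_out.
Qed.

(** In the inverse case, bijectivity makes a preimage of a node of length
    [n] a node of the same length, since an automorphism preserves lengths. *)
Lemma acts_on_children_group : perm_group_axiom
  [set f | bijective f /\ acts_on_children f].
Proof.
split.
- by move=> f [].
- split; first by exists id.
  by move=> w n; exists w, id => //; have [] := pg_axiom (G n).
- move=> f g [bf cf] [bg cg]; split; first exact: bij_comp.
  move=> w n; have [v [h Gh [gw gwx]]] := cg w n.
  have [v' [h' Gh' [fv fvx]]] := cf v n.
  have [_ _ Gcomp _] := pg_axiom (G n).
  exists v', (h' \o h); first exact: Gcomp.
  by split=> [|x] /=; rewrite ?gw ?gwx.
- move=> f f' [bf cf] fK f'K; split; first by exists f.
  move=> w n; have [v [m f'w]] := truncate_surj w (f' (truncate w n)).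
  have [v' [h Gh [fv fvx]]] := cf v m.
  have /truncateP[mn vw] : truncate v' m = truncate w n by rewrite -fv -f'w f'K.
  subst m; have [Gbij _ _ Ginv] := pg_axiom (G n).
  have [h' hK h'K] := Gbij h Gh; exists v, h'; first exact: Ginv Gh hK h'K.
  split=> // x; rewrite -[in LHS](h'K x) -(child_eq _ vw) -fvx fK //.
Qed.

(** The children of any node of length [n] form a copy of [X n]. Sending each
    such copy to another by an element of [G n] is preserved by composition and
    inversion, hence passes from the node actions to the generated group. *)
Lemma tree_group_children f : pg_set (tree_group G) f -> acts_on_children f.
Proof.
case/(_ [set f | bijective f /\ acts_on_children f]) => //.
split; first exact: acts_on_children_group.
move=> _ [s [g Gg ->]]; split; last exact: node_act_children.
by apply: (@node_actions_bij X G); exists s, g.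
Qed.

(** An automorphism fixing a node acts on its children through [G n], so
    definability in [X n] transfers to the children of any node of length [n],
    with that node as one more parameter. *)
Lemma tree_dcl_children w n (A : set (X n)) x : dcl (G n) A x ->
  dcl (tree_group G) ([set truncate w n] `|` @child w n @` A) (child w x).
Proof.
move=> Ax f [/tree_group_children/(_ w n)[v [h Gh [fw fwx]]] fA].
have /truncateP[_ vw] : truncate v n = truncate w n by rewrite -fw fA//; left.
rewrite fwx (child_eq _ vw) Ax//; split=> // a Aa.
apply: (@child_inj w); rewrite -(child_eq _ vw) -fwx fA//.
by right; exists a.
Qed.

Hypothesis X_nontrivial : forall n (x : X n), exists y, y <> x.
Hypothesis G_transitive : forall n, transitive_group (G n).

(** A node [t] other than the root is the child, with last entry [x], of some
    [s] of length [n]; let [t] be definable over [E]. If no element of [E]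
    properly extends [s], then every node action at [s] fixes [E] pointwise, and
    one of them moves [t] because [G n] is transitive and [X n] has another
    element. Hence [s] is one of finitely many proper initial segments of
    elements of [E]. An action at [s] by an element of [G n] that fixes the
    entries of index [n] of the elements of [E] fixes [E] pointwise, hence it
    fixes [t]; so [x] is definable over these finitely many entries. *)
Lemma tree_dcl_finite (w0 : forall n, X n) E :
  (forall n, dcl_locally_finite (G n)) ->
  finite_set E -> finite_set (dcl (tree_group G) E).
Proof.
move=> Gfin finE.
have [rep repP] : exists rep : tree -> forall n, X n,
    forall t, exists n, t = truncate (rep t) n.
  by have [rep repP] := choice (truncate_surj w0); exists rep.
(* Entries of index [n] are also taken from elements of [E] that are too short
   or do not extend the node at hand: more parameters only enlarge the
   definable closure, and [A n] stays finite. *)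
pose A n : set (X n) := [set rep e n | e in E].
apply: (@sub_finite_set _ _ ([set truncate w0 0] `|` \bigcup_(e in E)
  \bigcup_(n in `I_(tree_length e)) (@child (rep e) n @` dcl (G n) (A n)))).
  move=> t; have [w [[|n] ->]] := truncate_surj w0 t => dclt.
    by left; apply/truncateP.
  right; have [[e [Ee lt_ne ew]]|nE] := pselect (exists e,
    [/\ E e, (n < tree_length e)%N & forall i, (i < n)%N -> w i = rep e i]).
    exists e => //; exists n => //; exists (w n).
      move=> g [Gg gA].
      have : @node_act X (truncate w n) g (truncate w n.+1) = truncate w n.+1.
        apply: dclt; split; first exact: node_act_tree_group.
        move=> e' Ee'; have [m e'E] := repP e'; rewrite e'E.
        have [[lt_nm we']|] := pselect
          ((n < m)%N /\ forall i, (i < n)%N -> w i = rep e' i);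
            last exact: node_act_truncate_out.
        rewrite node_act_truncate// gA; last by exists e'.
        apply/truncateP; split=> // i _.
        by have [<-|ni] := eqVneq n i; rewrite ?dfwith_in ?dfwith_out.
      rewrite node_act_truncate// => /truncateP[_ /(_ n (leqnn _))].
      by rewrite dfwith_in.
    rewrite -(child_eq _ ew); apply/truncateP; split=> // i _.
    by have [<-|ni] := eqVneq n i; rewrite ?dfwith_in ?dfwith_out.
  have [y yw] := X_nontrivial (w n); have [g Gg gw] := G_transitive (w n) y.
  exfalso; apply: yw; rewrite -gw.
  have : @node_act X (truncate w n) g (truncate w n.+1) = truncate w n.+1.
    apply: dclt; split; first exact: node_act_tree_group.
    move=> e Ee; have [m eE] := repP e; rewrite [in RHS]eE {1}eE.
    apply: node_act_truncate_out => -[lt_nm we]; apply: nE.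
    exists e; split=> //.
    by rewrite eE.
  rewrite node_act_truncate// => /truncateP[_ /(_ n (leqnn _))].
  by rewrite dfwith_in.
rewrite finite_setU; split=> //.
apply: bigcup_finite => // e _; apply: bigcup_finite => // n _.
by apply: finite_image; apply: Gfin; apply: finite_image.
Qed.

End Tree.

Theorem theorem4p6 (X : nat -> Type) (G : forall n, perm_group (X n))
    (X_countably_infinite : forall n, [set: X n] #= [set: nat])
    (G_transitive : forall n, transitive_group (G n)) :
  card_in_Delta (FM_atoms (tree_group G)) <->
  forall n, dcl_locally_finite (G n).
Proof.
have X_seq n : exists2 x : nat -> X n, injective x & forall k, [set: X n] (x k).
  apply/infinite_set_injP/infiniteP.
  by have := X_countably_infinite n; rewrite card_eq_le => /andP[].
pose w n : X n := projT1 (cid2 (X_seq n)) 0.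
rewrite atoms_in_DeltaP; split=> [treefin n A finA|Gfin E finE]; last first.
  apply: (@tree_dcl_finite X G) => // n x; have [y yinj _] := X_seq n.
  have [y0x|] := pselect (y 0 = x); last by exists (y 0).
  by exists (y 1); rewrite -y0x => /yinj.
have finE : finite_set ([set @truncate X w n] `|` @child X w n @` A).
  by rewrite finite_setU; split; [exact: finite_set1|exact: finite_image].
apply: contrapT => /infinite_set_injP[x xinj xA].
apply: (infinite_set_injP _).2 (treefin _ finE).
exists (@child X w n \o x) => [|k].
  exact: inj_comp (@child_inj X w n) xinj.
by apply: tree_dcl_children; apply: xA.
Qed.
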